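(* Let $(V, e)$ be an order unit space. Put $$(S_V)_0 := C_V \cap (e - C_V) = \{ u \in V : \Vert u \Vert = \Vert e - u \Vert = 1 \}.$$ Then $S_V := (S_V)_0 \cup \{0, e\}$ is a skeleton in $V$ with $e$ as its head such that $(V, e)$ is the order unit space generated by $S_V$.
   Context: Notation: $\mathbb{R}^+ = [0,\infty)$. Order unit space: a real vector space $V$ with a proper Archimedean cone $V^+$ and an order unit $e \in V^+$ (for each $v \in V$ there is $k > 0$ with $ke \pm v \in V^+$; Archimedean means that $ke + v \in V^+$ for all $k > 0$ implies $v \in V^+$). The norm is the order unit norm $\Vert v \Vert = \inf\{k > 0 : ke \pm v \in V^+\}$. Put $C_V = \{u \in V^+ : \Vert u \Vert = 1\}$ and $e - C_V = \{e - u : u \in C_V\}$. Skeleton: Let $X$ be a non-zero real vector space and let $S \subset X$ contain $0$ and $e \neq 0$. Put $S_0 = S \setminus \{0, e\}$. $S$ is a skeleton with $e$ as its head if: (1) if $u \in S$, then $e - u \in S$; (2) if $u, v \in S$ and $\lambda \in [0,1]$, then there exist $w \in S_0$ and $\alpha, \beta \in \mathbb{R}^+$ such that $\lambda u + (1-\lambda) v = \alpha e + \beta w$; (3) if $e = \sum_{i=1}^n \alpha_i u_i$ for some $u_1, \dots, u_n \in S_0$ and $\alpha_1, \dots, \alpha_n > 0$ with $n \ge 2$, then $\sum_{i \neq j} \alpha_i \ge 1$ for all $j = 1, \dots, n$. The order unit space generated by a skeleton $S$ with head $e$ is $(W, W^+, e)$, where $W$ is the linear span of $S$ and $W^+$ is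 the cone generated by $S$ (all finite linear combinations of elements of $S$ with non-negative coefficients).
   Formalization: The formal theorem adds that V is not just the line Re (dim V ≥ 2); for V = Re with e ≠ 0 the set (S_V)_0 is empty, so skeleton condition (2) fails, and for V = 0 the head e would be 0. *)

(* Defs.v *)
From HB Require Import structures.
From mathcomp Require Import all_boot all_order all_algebra.
From mathcomp Require Import boolp classical_sets reals.
Set Implicit Arguments.
Unset Strict Implicit.
Unset Printing Implicit Defensive.
Import Order.TTheory GRing.Theory Num.Theory.
Local Open Scope classical_set_scope.
Local Open Scope ring_scope.

Section OrderUnitSpace.
Variables (R : realType) (V : lmodType R).
Implicit Types (P S : set V) (e u v w : V).

Record is_proper_cone P : Prop := IsProperCone {
  cone_nonempty : P !=set0;
  cone_add : forall u v, P u -> P v -> P (u + v);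
  cone_scale : forall (k : R) u, 0 <= k -> P u -> P (k *: u);
  cone_proper : forall u, P u -> P (- u) -> u = 0 }.

Record is_order_unit_space P e : Prop := IsOrderUnitSpace {
  ous_cone : is_proper_cone P;
  ous_unit_pos : P e;
  ous_unit : forall v, exists k : R, [/\ 0 < k, P (k *: e + v) & P (k *: e - v)];
  ous_archimedean : forall v, (forall k : R, 0 < k -> P (k *: e + v)) -> P v }.

Definition ou_norm P e v : R :=
  inf [set k : R | [/\ 0 < k, P (k *: e + v) & P (k *: e - v)]].

Definition C_V P e : set V := [set u | P u /\ ou_norm P e u = 1].

Definition S_V0 P e : set V := C_V P e `&` [set e - u | u in C_V P e].

Definition S_V P e : set V := S_V0 P e `|` [set 0; e].

(* The non-triviality of the ambient space is implied by [skel_head_neq0]. *)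
Record is_skeleton S e : Prop := IsSkeleton {
  skel_zero : S 0;
  skel_head : S e;
  skel_head_neq0 : e <> 0;
  skel_compl : forall u, S u -> S (e - u);
  skel_convex : forall u v (l : R), S u -> S v -> 0 <= l <= 1 ->
    exists w (a b : R), [/\ (S `\` [set 0; e]) w, 0 <= a, 0 <= b
      & l *: u + (1 - l) *: v = a *: e + b *: w];
  skel_sum : forall (n : nat) (u : 'I_n -> V) (a : 'I_n -> R),
    (2 <= n)%N -> (forall i, (S `\` [set 0; e]) (u i)) -> (forall i, 0 < a i) ->
    e = \sum_(i < n) a i *: u i ->
    forall j, 1 <= \sum_(i < n | i != j) a i }.

Definition linear_span S : set V :=
  [set v | exists (n : nat) (a : 'I_n -> R) (u : 'I_n -> V),
    (forall i, S (u i)) /\ v = \sum_(i < n) a i *: u i].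

Definition conic_span S : set V :=
  [set v | exists (n : nat) (a : 'I_n -> R) (u : 'I_n -> V),
    [/\ forall i, S (u i), forall i, 0 <= a i & v = \sum_(i < n) a i *: u i]].

Definition generated_space S e : set V * set V * V :=
  (linear_span S, conic_span S, e).

End OrderUnitSpace.

(* Main.v *)
Require Import Defs.
From HB Require Import structures.
From mathcomp Require Import all_boot all_order all_algebra.
From mathcomp Require Import boolp classical_sets reals.
Import Order.TTheory GRing.Theory Num.Theory.
Local Open Scope classical_set_scope.
Local Open Scope ring_scope.

(** Order a vector [v] against the multiples of [e]: the largest [l] with
    [l e <= v] and the smallest [m] with [v <= m e] both exist, because the cone
    is Archimedean ([best_lower_bound] and its mirror image under negation).
    The order unit norm being determined by these two numbers, the set
    [S_V0 P e] is exactly the set of vectors whose best bounds are [l = 0] and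
    [m = 1] ([S_V0P]).

    Any [v] that is not a multiple of [e] has [l < m], and the affine rescaling
    [w = (v - l e) / (m - l)] brings its bounds to [0] and [1].  Hence
    [v = l e + (m - l) w] with [w] in [S_V0 P e], and [l >= 0] when [v] is
    positive ([decomposition]).  This one formula gives the convexity axiom of a
    skeleton and both generation claims.  A multiple of [e] decomposes with coefficient
    [0] on some [w] in [S_V0 P e], which the rescaling of any vector that is not
    a multiple of [e] provides.

    For the last skeleton axiom, let [e = \sum_i a_i u_i] and let [s] be the sum
    of the [a_i] with [i != j].  Since [u_i <= e], one gets
    [e - a_j u_j <= s e], that is [(1 - s) / a_j *: e <= u_j]; the best lower
    bound of [u_j] being [0], this forces [s >= 1] ([skeleton_sum]). *)

(** * Bounds by multiples of the unit *)

Section OrderUnitSpaceTheory.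
Context (R : realType) (V : lmodType R) (P : set V) (e : V).
Hypothesis ousP : is_order_unit_space P e.
Implicit Types (u v w : V) (k l m : R).

Let coneP := ous_cone ousP.

Lemma cone0 : P 0.
Proof. by rewrite -(scale0r e); apply: (cone_scale coneP) => //; exact: ous_unit_pos ousP. Qed.

Lemma cone_unit k : 0 <= k -> P (k *: e).
Proof. by move=> k0; apply: (cone_scale coneP) => //; exact: ous_unit_pos ousP. Qed.

Lemma cone_sum (I : finType) (p : pred I) (F : I -> V) :
  (forall i, P (F i)) -> P (\sum_(i | p i) F i).
Proof. by move=> PF; elim/big_rec: _ => [|i v _]; [exact: cone0 | exact: cone_add]. Qed.

Lemma upper_boundW {k m v} : k <= m -> P (k *: e - v) -> P (m *: e - v).
Proof.
move=> km Pv; rewrite -(subrK k m) scalerDl -addrA.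
by apply: (cone_add coneP) => //; apply: cone_unit; rewrite subr_ge0.
Qed.

Lemma lower_boundW {k l v} : k <= l -> P (v - l *: e) -> P (v - k *: e).
Proof.
move=> kl Pv.
have -> : v - k *: e = (l - k) *: e + (v - l *: e).
  by rewrite scalerBl [RHS]addrC addrA subrK.
by apply: (cone_add coneP) => //; apply: cone_unit; rewrite subr_ge0.
Qed.

(** The Archimedean property in the form in which best bounds are attained. *)
Lemma archimedean_lower l v : (forall k, k < l -> P (v - k *: e)) -> P (v - l *: e).
Proof.
move=> Pv; apply: (ous_archimedean ousP) => k k0.
have -> : k *: e + (v - l *: e) = v - (l - k) *: e.
  by rewrite scalerBl opprB addrCA.
by apply: Pv; rewrite ltrBlDr ltrDl.
Qed.

(** * The unit sphere conditions as order bounds *)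

(** The lower bound [1] of the admissible [k] is itself admissible because the
    cone is Archimedean. *)
Lemma ou_norm1P v :
  ou_norm P e v = 1 <->
  [/\ P (e + v), P (e - v) &
      forall k, 0 < k -> P (k *: e + v) -> P (k *: e - v) -> 1 <= k].
Proof.
rewrite /ou_norm; set K := [set k | _].
have K_inf : has_inf K.
  split; first by have [k ?] := ous_unit ousP v; exists k.
  by exists 0 => k [/ltW].
split=> [infK|[Pp Pm lbK]].
- have PK k : 1 < k -> P (k *: e + v) /\ P (k *: e - v).
    rewrite -subr_gt0 => /(inf_adherent) /(_ K_inf)[c [_ Pp Pm]].
    rewrite infK addrC subrK => /ltW ck; split; last exact: upper_boundW ck Pm.
    by rewrite -[v]opprK; apply: (upper_boundW ck); rewrite opprK.
  split.
  + apply: (ous_archimedean ousP) => k k0; rewrite addrA -[X in _ + X + _]scale1r -scalerDl.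
    by apply: (PK _ _).1; rewrite ltrDr.
  + apply: (ous_archimedean ousP) => k k0; rewrite addrA -[X in _ + X - _]scale1r -scalerDl.
    by apply: (PK _ _).2; rewrite ltrDr.
  + by move=> k k0 Pp Pm; rewrite -infK; apply: (ge_inf K_inf.2).
- apply/eqP; rewrite eq_le; apply/andP; split.
  + by apply: (ge_inf K_inf.2); split=> //; rewrite scale1r.
  + by apply: lb_le_inf => [|k [*]]; [exact: K_inf.1 | exact: lbK].
Qed.

(** Positivity of [u] comes for free: the norm of [e - u] being [1] puts
    [e - (e - u)] in the cone. *)
Lemma S_V0E : S_V0 P e = [set u | ou_norm P e u = 1 /\ ou_norm P e (e - u) = 1].
Proof.
apply/seteqP; split=> u /=.
  by case=> -[_ nu] [w [_ nw] wE]; split=> //; rewrite -wE subKr.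
case=> nu neu; have [_ Peu _] := (ou_norm1P _).1 nu.
have [_ Pu _] := (ou_norm1P _).1 neu; rewrite subKr in Pu.
by split=> //; exists (e - u); rewrite ?subKr.
Qed.

(** The norm conditions say that the best bounds of [u] against multiples of [e]
    are [0] and [1].  In this form they can be checked on an affine rescaling of a
    vector whose best bounds are known. *)
Lemma S_V0P u : S_V0 P e u <->
  [/\ P u, P (e - u), forall k, P (u - k *: e) -> k <= 0 &
      forall k, P (k *: e - u) -> 1 <= k].
Proof.
have norm_bound w : P w -> (forall k, P (k *: e - w) -> 1 <= k) <->
    forall k, 0 < k -> P (k *: e + w) -> P (k *: e - w) -> 1 <= k.
  move=> Pw; split=> bnd k; first by move=> _ _; exact: bnd.
  (* a nonpositive upper bound would make 1/2 an upper bound *)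
  move=> Pk; have [k0|k0] := ltP 0 k.
    by apply: bnd => //; apply: (cone_add coneP) => //; apply/cone_unit/ltW.
  have h0 : 0 < 2^-1 :> R by rewrite invr_gt0.
  have : 1 <= 2^-1 :> R.
    apply: bnd => //; last exact: upper_boundW (le_trans k0 (ltW h0)) Pk.
    by apply: (cone_add coneP) => //; apply/cone_unit/ltW.
  by rewrite invf_ge1 // leNgt ltr1n.
rewrite S_V0E /=; split=> [[nu neu]|[Pu Peu lu mu]].
- have [_ Peu bu] := (ou_norm1P _).1 nu.
  have [_ Pu beu] := (ou_norm1P _).1 neu; rewrite subKr in Pu.
  split=> //; last exact/norm_bound.
  move=> k Pk; have := (norm_bound _ Peu).2 beu (1 - k).
  have -> : (1 - k) *: e - (e - u) = u - k *: e.
    by rewrite scalerBl scale1r opprB [LHS]addrC addrA subrK.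
  by move=> /(_ Pk); rewrite lerBrDr gerDl.
- split; apply/ou_norm1P; split=> //.
  + by apply: (cone_add coneP) => //; exact: ous_unit_pos ousP.
  + exact/norm_bound.
  + by apply: (cone_add coneP) => //; exact: ous_unit_pos ousP.
  + by rewrite subKr.
  + apply/norm_bound => // k Pk; rewrite -subr_le0; apply: lu.
    by move: Pk; rewrite scalerBl scale1r !opprB addrCA.
Qed.

Lemma S_V0_proper u : S_V0 P e u -> u <> 0 /\ u <> e.
Proof.
move=> /S_V0P[_ _ lu mu]; split=> uE; rewrite uE in lu mu.
- by have := mu 0; rewrite scale0r subrr ler10 => /(_ cone0).
- by have := lu 1; rewrite scale1r subrr ler10 => /(_ cone0).
Qed.

Lemma S_VD : S_V P e `\` [set 0; e] = S_V0 P e.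
Proof.
apply/seteqP; split=> u; first by case=> -[].
move=> Su; split; first by left.
by have [u0 ue] := S_V0_proper _ Su; case.
Qed.

Lemma S_V0_compl u : S_V0 P e u -> S_V0 P e (e - u).
Proof. by rewrite S_V0E /= subKr => -[]. Qed.

Lemma S_V_cone u : S_V P e u -> P u.
Proof. by case=> [/S_V0P[]//|[]->]; [exact: cone0 | exact: ous_unit_pos ousP]. Qed.

(** * Decomposition of a vector along the unit *)

Section NonzeroUnit.
Hypothesis e_neq0 : e <> 0.

Lemma cone_unit_ge0 k : P (k *: e) -> 0 <= k.
Proof.
move=> Pk; rewrite leNgt; apply/negP => k0; apply: e_neq0.
apply: (cone_proper coneP); first exact: ous_unit_pos ousP.
have -> : - e = (- k)^-1 *: (k *: e).
  by rewrite scalerA invrN mulNr mulVf ?scaleN1r // lt_eqF.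
by apply: (cone_scale coneP) => //; rewrite invr_ge0 oppr_ge0 ltW.
Qed.

Lemma lower_le_upper {l m v} : P (v - l *: e) -> P (m *: e - v) -> l <= m.
Proof.
move=> Pl Pm; rewrite -subr_ge0; apply: cone_unit_ge0.
by rewrite scalerBl -(subrK v (m *: e)) -addrA; apply: (cone_add coneP).
Qed.

Lemma best_lower_bound v :
  exists2 l, P (v - l *: e) & forall k, P (v - k *: e) -> k <= l.
Proof.
have [c [c0 Pcp Pcm]] := ous_unit ousP v.
pose L := [set k | P (v - k *: e)].
have supL : has_sup L.
  split; first by exists (- c); rewrite /L /= scaleNr opprK addrC.
  by exists c => k /= Pk; exact: lower_le_upper Pk Pcm.
exists (sup L); last by move=> k Pk; exact: (ub_le_sup supL.2 Pk).
apply: archimedean_lower => k ksup.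
have : 0 < sup L - k by rewrite subr_gt0.
move=> /(sup_adherent) /(_ supL)[l Pl]; rewrite subKr => kl.
exact: lower_boundW (ltW kl) Pl.
Qed.

Lemma best_upper_bound v :
  exists2 m, P (m *: e - v) & forall k, P (k *: e - v) -> m <= k.
Proof.
have [l Pl lmax] := best_lower_bound (- v).
exists (- l) => [|k Pk]; first by rewrite scaleNr addrC.
by rewrite lerNl; apply: lmax; rewrite scaleNr opprK addrC.
Qed.

(** The vector [w] is [v] rescaled so that its best bounds become [0] and [1];
    the best bounds of [v] differ because the cone is proper. *)
Lemma decomposition_nonmultiple v : (forall a, v <> a *: e) ->
  exists w l b, [/\ S_V0 P e w, P v -> 0 <= l, 0 <= b & v = l *: e + b *: w].
Proof.
move=> vNe.
have [l Pl lmax] := best_lower_bound v.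
have [m Pm mmin] := best_upper_bound v.
have lm : l < m.
  rewrite lt_neqAle (lower_le_upper Pl Pm) andbT; apply/eqP => lmE.
  apply: (vNe l); apply/subr0_eq/(cone_proper coneP) => //.
  by rewrite opprB {1}lmE.
have b0 : 0 < m - l by rewrite subr_gt0.
have bN0 : m - l != 0 by rewrite gt_eqF.
have [w vE] : exists w, v = l *: e + (m - l) *: w.
  exists ((m - l)^-1 *: (v - l *: e)).
  by rewrite scalerA mulfV // scale1r addrC subrK.
(* bounds of [w] are, up to the positive factor [m - l], those of [v] *)
have upper k : (m - l) *: (k *: e - w) = (l + (m - l) * k) *: e - v.
  by rewrite [X in _ = _ - X]vE scalerBr scalerA [(l + _) *: e]scalerDl opprD addrACA subrr add0r.
have lower k : (m - l) *: (w - k *: e) = v - (l + (m - l) * k) *: e.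
  by rewrite -[w - _]opprB scalerN upper opprB.
have scaleP x : P ((m - l) *: x) <-> P x.
  split=> [Px|]; last exact/(cone_scale coneP)/ltW.
  rewrite -(scale1r x) -(mulVf bN0) -scalerA.
  by apply: (cone_scale coneP) => //; rewrite invr_ge0 ltW.
exists w, l, (m - l); split=> //; [|by move=> Pv; apply: lmax; rewrite scale0r subr0|exact: ltW].
apply/S_V0P; split.
- by rewrite -[w]subr0 -(scale0r e); apply/scaleP; rewrite lower mulr0 addr0.
- by rewrite -[X in X - w]scale1r; apply/scaleP; rewrite upper mulr1 [l + _]addrC subrK.
- move=> k /scaleP; rewrite lower => /lmax.
  by rewrite gerDl pmulr_rle0.
- move=> k /scaleP; rewrite upper => /mmin.
  by rewrite -lerBlDl ler_pMr.
Qed.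

End NonzeroUnit.

Section NonmultipleExists.
Hypothesis hdim : exists v, forall a : R, v <> a *: e.

(** If [e] were [0], every vector would be both positive and negative. *)
Lemma unit_neq0 : e <> 0.
Proof.
move=> e0; have [v vNe] := hdim; apply: (vNe 0); rewrite scale0r.
have [k [_]] := ous_unit ousP v; rewrite e0 scaler0 sub0r add0r.
exact: cone_proper.
Qed.

Lemma decomposition v :
  exists w l b, [/\ S_V0 P e w, P v -> 0 <= l, 0 <= b & v = l *: e + b *: w].
Proof.
have [[a ->]|] := pselect (exists a : R, v = a *: e); last first.
  by move=> /forallNP; exact: decomposition_nonmultiple unit_neq0 v.
have [v0 /(decomposition_nonmultiple unit_neq0)[w [_ [_ [Sw _ _ _]]]]] := hdim.
exists w, a, 0; split=> //; last by rewrite scale0r addr0.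
exact: cone_unit_ge0 unit_neq0 a.
Qed.

(** * The skeleton and the space it generates *)

(** Bounding every [u i] with [i != j] by [e] leaves a multiple of [e] below
    [u j], whose coefficient cannot be positive. *)
Lemma skeleton_sum (n : nat) (u : 'I_n -> V) (a : 'I_n -> R) :
  (forall i, S_V0 P e (u i)) -> (forall i, 0 < a i) ->
  e = \sum_(i < n) a i *: u i -> forall j, 1 <= \sum_(i < n | i != j) a i.
Proof.
move=> Su a0 eE j; set s := \sum_(i < n | _) _.
have [_ _ lu _] := (S_V0P _).1 (Su j).
have /lu : P (u j - ((a j)^-1 * (1 - s)) *: e).
  have -> : u j - ((a j)^-1 * (1 - s)) *: e =
            (a j)^-1 *: (\sum_(i < n | i != j) a i *: (e - u i)).
    under eq_bigr do rewrite scalerBr.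
    rewrite sumrB -scaler_suml -/s.
    have -> : \sum_(i < n | i != j) a i *: u i = e - a j *: u j.
      by apply/eqP; rewrite eq_sym subr_eq [X in X == _]eE (bigD1 j) //= addrC.
    rewrite opprB addrCA -[X in s *: e - X]scale1r -scalerBl scalerDr !scalerA.
    by rewrite mulVf ?gt_eqF // scale1r -[1 - s]opprB mulrN scaleNr opprK.
  apply: (cone_scale coneP); first by rewrite invr_ge0 ltW.
  apply: cone_sum => i; apply: (cone_scale coneP); first exact: ltW.
  by have [] := (S_V0P _).1 (Su i).
by rewrite pmulr_rle0 ?invr_gt0 // subr_le0.
Qed.

Lemma S_V_skeleton : is_skeleton (S_V P e) e.
Proof.
split.
- by right; left.
- by right; right.
- exact: unit_neq0.
- move=> u [/S_V0_compl|[]->]; first by left.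
  + by right; right; rewrite subr0.
  + by right; left; rewrite subrr.
- move=> u v l /S_V_cone Pu /S_V_cone Pv /andP[l0 l1].
  have [w [a [b [Sw a0 b0 E]]]] := decomposition (l *: u + (1 - l) *: v).
  exists w, a, b; split=> //; first by rewrite S_VD.
  apply: a0; apply: (cone_add coneP); apply: (cone_scale coneP) => //.
  by rewrite subr_ge0.
- by move=> n u a _; rewrite S_VD; exact: skeleton_sum.
Qed.

Lemma S_V_combination v :
  exists (a : 'I_2 -> R) (u : 'I_2 -> V),
    [/\ forall i, S_V P e (u i), P v -> forall i, 0 <= a i &
        v = \sum_(i < 2) a i *: u i].
Proof.
have [w [l [b [Sw l0 b0 vE]]]] := decomposition v.
exists (fun i => if i == ord0 then l else b), (fun i => if i == ord0 then e else w).
split.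
- by move=> i; case: ifP => _; [right; right | left].
- by move=> Pv i; case: ifP => _ //; exact: l0.
- by rewrite big_ord_recl big_ord1.
Qed.

Lemma linear_span_S_V : linear_span (S_V P e) = [set: V].
Proof.
apply/seteqP; split=> // v _.
by have [a [u [Su _ vE]]] := S_V_combination v; exists 2%N, a, u.
Qed.

Lemma conic_span_S_V : conic_span (S_V P e) = P.
Proof.
apply/seteqP; split=> [v [n [a [u [Su a0 ->]]]]|v Pv].
  apply: cone_sum => i; apply: (cone_scale coneP) => //.
  exact: S_V_cone _ (Su i).
by have [a [u [Su /(_ Pv) a0 vE]]] := S_V_combination v; exists 2%N, a, u.
Qed.

End NonmultipleExists.
End OrderUnitSpaceTheory.

Theorem theorem1p3 (R : realType) (V : lmodType R) (Vplus : set V) (e : V)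
    (hV : is_order_unit_space Vplus e)
    (hdim : exists v : V, forall a : R, v <> a *: e) :
  [/\ S_V0 Vplus e =
        [set u | ou_norm Vplus e u = 1 /\ ou_norm Vplus e (e - u) = 1],
      is_skeleton (S_V Vplus e) e
    & generated_space (S_V Vplus e) e = ([set: V], Vplus, e)].
Proof.
split.
- exact: S_V0E.
- exact: S_V_skeleton.
- by rewrite /generated_space linear_span_S_V ?conic_span_S_V.
Qed.
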